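(* Let $\mathfrak C$ be a left cancellative small category. Then $I_l\,\bar\ltimes\,\partial\Omega$ is Hausdorff if and only if for all $s\in I_l$ there exist $\varepsilon_1,\dots,\varepsilon_n\in\bar{\mathcal J}$ with $s\varepsilon_i=\varepsilon_i$ such that for all $\emptyset\ne e\in\mathcal J$ with $se=e$ there exists $1\le i\le n$ such that $e\varepsilon_i\ne\emptyset$.
   Context: $\mathfrak C$ denotes the set of morphisms, $\mathfrak C^0\subseteq\mathfrak C$ the identity morphisms, $\mathfrak d,\mathfrak t$ domain and target; $cd$ is defined iff $\mathfrak d(c)=\mathfrak t(d)$; left cancellative means $cx=cy\Rightarrow x=y$. Each $c\in\mathfrak C$ gives the partial bijection $\mathfrak d(c)\mathfrak C\to c\mathfrak C$, $x\mapsto cx$; $I_l$ is the smallest semigroup of partial bijections of $\mathfrak C$ containing these and closed under inverses; $\mathcal J=\{\mathrm{dom}(s):s\in I_l\}$ is its semilattice of idempotents (product = intersection). $\bar{\mathcal J}$ is the set of subsets $\varepsilon=e\setminus\bigcup_{i=1}^nf_i$ of $\mathfrak C$ with $e,f_1,\dots,f_n\in\mathcal J$, $f_i\subseteq e$. For $s\in I_l$ and a set $\varepsilon\in\bar{\mathcal J}$, $s\varepsilon$ is the restriction of $s$ to $\varepsilon\cap\mathrm{dom}(s)$; $s\varepsilon=\varepsilon$ means $\varepsilon\subseteq\mathrm{dom}(s)$ and $s(x)=x$ for all $x\in\varepsilon$; $e\varepsilon=e\cap\varepsilon$. The list $\varepsilon_1,\dots,\varepsilon_n$ may be empty. $\widehat{\mathcal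 J}$ is the space of non-zero multiplicative maps $\chi:\mathcal J\to\{0,1\}$ with $\chi(\emptyset)=0$ if $\emptyset\in\mathcal J$ (pointwise convergence). $\Omega\subseteq\widehat{\mathcal J}$ consists of those $\chi$ such that whenever $e=\bigcup_{i=1}^nf_i$ ($e,f_i\in\mathcal J$) and $\chi(e)=1$, then $\chi(f_i)=1$ for some $i$. For $\chi\in\Omega$, $\varepsilon=e\setminus\bigcup f_i\in\bar{\mathcal J}$, put $\chi(\varepsilon)=1$ iff $\chi(e)=1$ and all $\chi(f_i)=0$, and $\chi(\varepsilon)=0$ otherwise. $\partial\Omega\subseteq\Omega$ is the closure of the set of $\chi\in\widehat{\mathcal J}$ with $\chi^{-1}(1)$ maximal. $s\in I_l$ acts by $\chi\mapsto s.\chi=\chi(s^{-1}\cdot s)$ from $\{\chi\in\partial\Omega:\chi(s^{-1}s)=1\}$ onto $\{\chi\in\partial\Omega:\chi(ss^{-1})=1\}$. $I_l\,\bar\ltimes\,\partial\Omega$ is the groupoid of classes $[s,\chi]^{\bar\sim}$, $s\in I_l$, $\chi\in\partial\Omega$, $\chi(s^{-1}s)=1$, where $(s,\chi)\bar\sim(t,\psi)$ iff $\chi=\psi$ and $s\varepsilon=t\varepsilon$ for some $\varepsilon\in\bar{\mathcal J}$ with $\chi(\varepsilon)=1$; source $\chi$, range $s.\chi$; topology such that the sets $\{[s,\chi]^{\bar\sim}:\chi(s^{-1}s)=1\}$ are open and mapped homeomorphically by the source map onto $\{\chi\in\partial\Omega:\chi(s^{-1}s)=1\}$. *)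

(* Defs.v *)
From HB Require Import structures.
From mathcomp Require Import all_boot all_order all_algebra.
From mathcomp Require Import all_classical all_reals.
From mathcomp Require Import topology.

Set Implicit Arguments.
Unset Strict Implicit.
Unset Printing Implicit Defensive.

Local Open Scope classical_set_scope.

(* A small category given by its set of morphisms; objects are identified with
   identity morphisms, so [cat_dom c] and [cat_cod c] are identities.  The
   composite [cat_comp c d] is meaningful only if [cat_dom c = cat_cod d] and
   is arbitrary otherwise. *)
Record smallCategory := SmallCategory {
  mor :> Type;
  cat_dom : mor -> mor;
  cat_cod : mor -> mor;
  cat_comp : mor -> mor -> mor;
  cat_dom_dom : forall c, cat_dom (cat_dom c) = cat_dom c;
  cat_cod_dom : forall c, cat_cod (cat_dom c) = cat_dom c;
  cat_dom_cod : forall c, cat_dom (cat_cod c) = cat_cod c;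
  cat_cod_cod : forall c, cat_cod (cat_cod c) = cat_cod c;
  cat_dom_comp : forall c d,
    cat_dom c = cat_cod d -> cat_dom (cat_comp c d) = cat_dom d;
  cat_cod_comp : forall c d,
    cat_dom c = cat_cod d -> cat_cod (cat_comp c d) = cat_cod c;
  cat_comp1m : forall c, cat_comp (cat_cod c) c = c;
  cat_compm1 : forall c, cat_comp c (cat_dom c) = c;
  cat_compA : forall b c d, cat_dom b = cat_cod c -> cat_dom c = cat_cod d ->
    cat_comp b (cat_comp c d) = cat_comp (cat_comp b c) d
}.

Definition left_cancellative (C : smallCategory) : Prop :=
  forall c x y : C, cat_dom c = cat_cod x -> cat_dom c = cat_cod y ->
    cat_comp c x = cat_comp c y -> x = y.

(* [s x y] means that [x] is in the domain of [s] and [s(x) = y]. *)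
Record pbij (T : Type) := PBij {
  pgraph :> T -> T -> Prop;
  pbij_fun : forall x y z, pgraph x y -> pgraph x z -> y = z;
  pbij_inj : forall x y z, pgraph x z -> pgraph y z -> x = y
}.

HB.instance Definition _ (T : Type) := gen_eqMixin (pbij T).
HB.instance Definition _ (T : Type) := gen_choiceMixin (pbij T).

Section PartialBijections.
Variable T : Type.
Implicit Types (s t : pbij T) (A : set T).

Lemma pbij_eq s t : (forall x y, s x y <-> t x y) -> s = t.
Proof.
case: s t => [f f1 f2] [g g1 g2] /= fg.
have E : f = g by apply/funext => x; apply/funext => y; apply/propext.
by subst g; congr PBij; exact: Prop_irrelevance.
Qed.

Definition pbdom s : set T := [set x | exists y, s x y].

Lemma pbinv_fun s x y z : s y x -> s z x -> y = z.
Proof. exact: pbij_inj. Qed.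

Lemma pbinv_inj s x y z : s z x -> s z y -> x = y.
Proof. exact: pbij_fun. Qed.

Definition pbinv s : pbij T :=
  @PBij T (fun x y => s y x) (@pbinv_fun s) (@pbinv_inj s).

Definition comp_graph s t (x z : T) : Prop := exists2 y, t x y & s y z.

Lemma pbcomp_fun s t x y z : comp_graph s t x y -> comp_graph s t x z -> y = z.
Proof.
by move=> [u txu suy] [v txv]; rewrite -(pbij_fun txu txv); exact: pbij_fun.
Qed.

Lemma pbcomp_inj s t x y z : comp_graph s t x z -> comp_graph s t y z -> x = y.
Proof.
move=> [u txu suz] [v tyv svz]; move: tyv.
by rewrite -(pbij_inj suz svz); exact: pbij_inj.
Qed.

(* [pbcomp s t] is [x |-> s (t x)]. *)
Definition pbcomp s t : pbij T := PBij (@pbcomp_fun s t) (@pbcomp_inj s t).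

Lemma pbrestr_fun s A x y z : A x /\ s x y -> A x /\ s x z -> y = z.
Proof. by move=> [_ +] [_]; exact: pbij_fun. Qed.

Lemma pbrestr_inj s A x y z : A x /\ s x z -> A y /\ s y z -> x = y.
Proof. by move=> [_ +] [_]; exact: pbij_inj. Qed.

Definition pbrestr s A : pbij T :=
  @PBij T (fun x y => A x /\ s x y) (@pbrestr_fun s A) (@pbrestr_inj s A).

Definition pbfixes s A : Prop := A `<=` pbdom s /\ forall x, A x -> s x x.

End PartialBijections.

Section LeftInverseHull.
Variable C : smallCategory.

(* The set [d(c)C] is [[set x | cat_dom c = cat_cod x]].  Left cancellation is
   what makes [x |-> c x] a partial bijection, so that every [c] contributes
   one element. *)
Definition left_mults : set (pbij C) :=
  [set s | exists c : C,
     forall x y, s x y <-> cat_dom c = cat_cod x /\ y = cat_comp c x].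

Definition inverse_semigroup_closed (S : set (pbij C)) : Prop :=
  (forall s t, S s -> S t -> S (pbcomp s t)) /\ (forall s, S s -> S (pbinv s)).

Definition Il : set (pbij C) := smallest inverse_semigroup_closed left_mults.

Definition J : set (set C) := @pbdom C @` Il.

Definition Jbar : set (set C) :=
  [set eps | exists (e : J) (n : nat) (f : 'I_n -> J),
     (forall i, set_val (f i) `<=` set_val e) /\
     eps = set_val e `\` \bigcup_i set_val (f i)].

Lemma Il_comp s t : Il s -> Il t -> Il (pbcomp s t).
Proof.
by move=> Is It S SC; apply: SC.1.1; [exact: (Is S SC)|exact: (It S SC)].
Qed.

Lemma Il_inv s : Il s -> Il (pbinv s).
Proof. by move=> Is S SC; apply: SC.1.2; exact: (Is S SC). Qed.

Lemma J_setI e f : J e -> J f -> J (e `&` f).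
Proof.
move=> [s Is <-] [t It <-].
exists (pbcomp t (pbcomp (pbinv s) s)).
  by apply: Il_comp => //; apply: Il_comp => //; exact: Il_inv.
apply/seteqP; split=> x.
  move=> [y [z [w /= sxw szw] tzy]].
  have xz := pbij_inj sxw szw; subst z.
  by split; [exists w|exists y].
move=> [[w sxw] [y txy]]; exists y; exists x => //.
by exists w.
Qed.

Definition Jmeet (e f : J) : J :=
  exist _ (set_val e `&` set_val f)
    (mem_set (J_setI (set_valP e) (set_valP f))).

Lemma J_pbdom s : Il s -> J (pbdom s).
Proof. by move=> Is; exists s. Qed.

(* the idempotent [s^-1 s] *)
Definition Jdom (s : Il) : J :=
  exist _ (pbdom (set_val s)) (mem_set (J_pbdom (set_valP s))).

(* Characters are nonzero multiplicative maps [J -> {0,1}]; as a [set] of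
   [{ptws J -> bool}], [Jhat] carries the topology of pointwise convergence. *)
Definition Jhat : set {ptws J -> bool} :=
  [set chi | [/\ exists e, chi e = true,
                 forall e f, chi (Jmeet e f) = chi e && chi f &
                 forall e, set_val e = set0 -> chi e = false]].

Definition chr (chi : Jhat) (e : J) : bool := set_val chi e.

Definition Omega : set Jhat :=
  [set chi | forall (e : J) (n : nat) (f : 'I_n -> J),
     set_val e = \bigcup_i set_val (f i) -> chr chi e ->
     exists i, chr chi (f i)].

Definition maximal_chr : set Jhat :=
  [set chi | forall psi : Jhat,
     [set e | chr chi e] `<=` [set e | chr psi e] ->
     [set e | chr psi e] = [set e | chr chi e]].

Definition bdryOmega : set Jhat := closure maximal_chr.

(* The value [chi(eps)].  For [chi] in [Omega] it does not depend on the way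
   [eps] is written, see [chrbarE]. *)
Definition chrbar (chi : Jhat) (eps : set C) : Prop :=
  exists (e : J) (n : nat) (f : 'I_n -> J),
    [/\ forall i, set_val (f i) `<=` set_val e,
        eps = set_val e `\` \bigcup_i set_val (f i),
        chr chi e & forall i, ~~ chr chi (f i)].

Lemma J_inj (e f : J) : set_val e = set_val f -> e = f.
Proof. by move=> ef; apply: val_inj. Qed.

Lemma chrI (chi : Jhat) e f : chr chi (Jmeet e f) = chr chi e && chr chi f.
Proof. by case: (set_valP chi). Qed.

Lemma Omega_cover (chi : Jhat) (e : J) n (f : 'I_n -> J) :
  Omega chi -> set_val e `<=` \bigcup_i set_val (f i) ->
  chr chi e -> exists i, chr chi (f i).
Proof.
move=> Ochi ef chie.
have [i] : exists i, chr chi (Jmeet e (f i)).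
  apply: (Ochi e) => //; apply/seteqP; split=> x.
    by move=> ex; have [i _ fx] := ef _ ex; exists i.
  by move=> [i _ []].
by rewrite chrI => /andP[_ fi]; exists i.
Qed.

Lemma chrbarE (chi : Jhat) (e : J) n (f : 'I_n -> J) :
  Omega chi -> (forall i, set_val (f i) `<=` set_val e) ->
  chrbar chi (set_val e `\` \bigcup_i set_val (f i)) <->
  chr chi e /\ forall i, ~~ chr chi (f i).
Proof.
move=> Ochi fe; split; last first.
  by move=> [chie chif]; exists e, n, f.
move=> [e' [n' [f' [fe' E chie' chif']]]].
have chie : chr chi e.
  apply: contrapT => /negP nchie.
  pose g (i : 'I_n'.+1) := if unlift ord0 i is Some j then f' j else Jmeet e' e.
  have [i] : exists i, chr chi (g i).
    apply: (Omega_cover Ochi _ chie') => x e'x.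
    have [[j _ fx]|nf] := pselect ((\bigcup_i set_val (f' i)) x).
      by exists (lift ord0 j) => //; rewrite /g liftK.
    exists ord0 => //; rewrite /g unlift_none /=; split=> //.
    have : (set_val e' `\` \bigcup_i set_val (f' i)) x by [].
    by rewrite -E => -[].
  rewrite /g; case: unliftP => [j _|_]; first by rewrite (negbTE (chif' j)).
  by rewrite chrI (negbTE nchie) andbF.
split=> // j; apply/negP => chifj.
have [i] : exists i, chr chi (f' i).
  apply: (@Omega_cover chi (Jmeet (f j) e')) => //; last first.
    by rewrite chrI chifj.
  move=> x [/= fjx e'x]; apply: contrapT => nf.
  have : (set_val e' `\` \bigcup_i set_val (f' i)) x by [].
  by rewrite -E => -[_]; apply; exists j.
by apply/negP.
Qed.

Lemma chrbarI (chi : Jhat) eps eta :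
  chrbar chi eps -> chrbar chi eta -> chrbar chi (eps `&` eta).
Proof.
move=> [e [n [f [fe -> chie chif]]]] [e' [n' [f' [fe' -> chie' chif']]]].
pose g (i : 'I_(n + n')) := Jmeet (Jmeet e e')
  (match fintype.split i with inl j => f j | inr j => f' j end).
exists (Jmeet e e'), (n + n')%N, g; split.
- by move=> i x /= [].
- apply/seteqP; split=> x.
    move=> [[ex nf] [e'x nf']]; split=> // -[i _] /= [_].
    by case: fintype.splitP => j _ fx; [apply: nf|apply: nf']; exists j.
  move=> [/= [ex e'x] nf]; split; split=> // -[j _ fx]; apply: nf.
    exists (lshift n' j) => //=; split=> //.
    by rewrite -[lshift n' j]/(unsplit (inl j)) unsplitK.
  exists (rshift n j) => //=; split=> //.
  by rewrite -[rshift n j]/(unsplit (inr j)) unsplitK.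
- by rewrite chrI chie.
- move=> i; rewrite !chrI chie chie' /=.
  by case: fintype.splitP.
Qed.

Lemma chrbar_Jbar chi eps : chrbar chi eps -> Jbar eps.
Proof. by move=> [e [n [f [? ? _ _]]]]; exists e, n, f. Qed.

Lemma chr_open (e : J) b : open [set chi : Jhat | chr chi e = b].
Proof.
exists ((fun chi : {ptws J -> bool} => chi e) @^-1` [set b]) => //.
apply: open_comp; last exact: discrete_open.
by move=> chi _; exact: (@proj_continuous _ (fun=> bool) e).
Qed.

Lemma chrbar_near (chi : Jhat) eps :
  chrbar chi eps -> \forall psi \near chi, chrbar psi eps.
Proof.
move=> [e [n [f [fe -> chie chif]]]].
have Ne : \forall psi \near chi, chr psi e.
  exact: (open_nbhs_nbhs (conj (chr_open e true) chie)).
have Nf : \forall psi \near chi, forall i, chr psi (f i) = false.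
  apply: (@filter_forall _ 'I_n
    (fun i => [set psi | chr psi (f i) = false]) (nbhs chi)) => i.
  apply: open_nbhs_nbhs; split; first exact: (chr_open (f i) false).
  exact/negbTE.
near=> psi; exists e, n, f; split=> //; first by near: psi.
by move=> i; apply/negbT; move: i; near: psi.
Unshelve. all: by end_near. Qed.

Lemma maximal_chr_Omega : maximal_chr `<=` Omega.
Proof.
move=> chi chimax e n f ef chie; apply: contrapT => nf.
have sep i : exists2 g, chr chi g & set_val g `&` set_val (f i) = set0.
  apply: contrapT => nsep.
  pose psi (h : J) := `[< exists2 g, chr chi g &
    set_val g `&` set_val (f i) `<=` set_val h >].
  have psiP : Jhat psi.
    split.
    - by exists (f i); apply/asboolP; exists e => // x [].
    - move=> a b; apply/asboolP/andP.
        by move=> [g chig H]; split; apply/asboolP; exists g => // x /H[].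
      move=> [/asboolP[g chig ga] /asboolP[h chih hb]].
      exists (Jmeet g h); first by rewrite chrI chig.
      by move=> x [[gx hx] fx]; split; [apply: ga|apply: hb].
    - move=> a a0; apply/asboolP => -[g chig]; rewrite a0 subset0 => H.
      by apply: nsep; exists g.
  have /chimax E : [set h | chr chi h] `<=`
      [set h | chr (exist _ psi (mem_set psiP)) h].
    by move=> h /= chih; apply/asboolP; exists h => // x [].
  apply: nf; exists i.
  suff : [set h | chr chi h] (f i) by [].
  by rewrite -E /=; apply/asboolP; exists e => // x [].
have /(_ n)[g chig gf] : forall m, exists2 g, chr chi g &
    forall i : 'I_n, (i < m)%N -> set_val g `&` set_val (f i) = set0.
  elim=> [|k [g chig gf]]; first by exists e.
  have [kn|kn] := ltnP k n; last first.
    by exists g => // i _; apply: gf; exact: leq_trans kn.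
  have [h chih hf] := sep (Ordinal kn).
  exists (Jmeet g h); first by rewrite chrI chig.
  move=> i; rewrite ltnS leq_eqVlt => /orP[/eqP ik|ik];
    apply/seteqP; split=> // x [[gx hx] fx].
    have : (set_val h `&` set_val (f (Ordinal kn))) x.
      by split=> //; rewrite (_ : Ordinal kn = i) //; exact: val_inj.
    by rewrite hf.
  have : (set_val g `&` set_val (f i)) x by [].
  by rewrite gf.
have : chr chi (Jmeet e g) by rewrite chrI chie.
suff -> : chr chi (Jmeet e g) = false by [].
have [_ _ chi0] := set_valP chi; apply: chi0.
apply/seteqP; split=> // x [ex gx].
have [i _ fx] : (\bigcup_i set_val (f i)) x by rewrite -ef.
have : (set_val g `&` set_val (f i)) x by [].
by rewrite gf.
Qed.

Lemma bdryOmega_Omega : bdryOmega `<=` Omega.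
Proof.
move=> chi chicl e n f ef chie; apply: contrapT => nf.
have Ne : \forall psi \near chi, chr psi e.
  exact: (open_nbhs_nbhs (conj (chr_open e true) chie)).
have Nf : \forall psi \near chi, forall i, chr psi (f i) = false.
  apply: (@filter_forall _ 'I_n
    (fun i => [set psi | chr psi (f i) = false]) (nbhs chi)) => i.
  apply: open_nbhs_nbhs; split; first exact: (chr_open (f i) false).
  by apply/negP => H; apply: nf; exists i.
have [psi [/maximal_chr_Omega psiO [psie psif]]] := chicl _ (filterI Ne Nf).
by have [i] := psiO e n f ef psie; rewrite psif.
Qed.

Definition bdry_chr (chi : bdryOmega) : Jhat := set_val chi.

Definition act_dom (s : Il) : set bdryOmega :=
  [set chi | chr (bdry_chr chi) (Jdom s)].

(* The pairs [(s, chi)] with [chi] in the boundary and [chi (s^-1 s) = 1], with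
   the topology of the disjoint union over [s] of the spaces [act_dom s]. *)
Definition germ_pairs : Type := {s : Il & act_dom s}.

Definition germ_elt (p : germ_pairs) : pbij C := set_val (projT1 p).
Definition germ_chr (p : germ_pairs) : bdryOmega := set_val (projT2 p).

Definition germ_equiv (p q : germ_pairs) : bool :=
  `[< germ_chr p = germ_chr q /\
      exists2 eps, Jbar eps & chrbar (bdry_chr (germ_chr p)) eps /\
        pbrestr (germ_elt p) eps = pbrestr (germ_elt q) eps >].

Lemma germ_equiv_refl : reflexive germ_equiv.
Proof.
move=> p; apply/asboolP; split=> //.
have [e chie] : exists e, chr (bdry_chr (germ_chr p)) e.
  by have [[e chie] _ _] := set_valP (bdry_chr (germ_chr p)); exists e.
have ce : chrbar (bdry_chr (germ_chr p))
    (set_val e `\` \bigcup_(i : 'I_0) set_val e).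
  by exists e, 0%N, (fun=> e); split=> // -[].
exists (set_val e `\` \bigcup_(i : 'I_0) set_val e) => //.
exact: chrbar_Jbar ce.
Qed.

Lemma germ_equiv_sym : symmetric germ_equiv.
Proof.
suff H p q : germ_equiv p q -> germ_equiv q p.
  by move=> p q; apply/idP/idP; exact: H.
move=> /asboolP[pq [eps Jeps [ceps E]]]; apply/asboolP; split=> //.
by exists eps => //; rewrite -pq.
Qed.

Lemma pbrestrI (s t : pbij C) A B :
  pbrestr s A = pbrestr t A -> pbrestr s (A `&` B) = pbrestr t (A `&` B).
Proof.
move=> E; apply: pbij_eq => x y /=.
have : pbrestr s A x y <-> pbrestr t A x y by rewrite E.
by move=> /= H; split=> -[[Ax Bx] xy]; split=> //; apply H.
Qed.

Lemma germ_equiv_trans : transitive germ_equiv.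
Proof.
move=> q p r /asboolP[pq [eps Jeps [ceps E]]] /asboolP[qr [eta Jeta [ceta F]]].
apply/asboolP; split; first by rewrite pq.
have ci : chrbar (bdry_chr (germ_chr p)) (eps `&` eta).
  by apply: chrbarI => //; rewrite pq.
exists (eps `&` eta); first exact: chrbar_Jbar ci.
split=> //; rewrite (pbrestrI _ E) setIC; exact: pbrestrI.
Qed.

Canonical germ_equivR :=
  EquivRel germ_equiv germ_equiv_refl germ_equiv_sym germ_equiv_trans.

(* The set of arrows with the quotient topology: [W] is open iff, for every
   [s], the set of [chi] in [act_dom s] with [germ chi] in [W] is open in
   [act_dom s].  The Hausdorff property involves only this space and not the
   product of the groupoid. *)
Definition germ_groupoid : topologicalType :=
  quotient_topology {eq_quot germ_equivR}%qT.

Definition germ (s : Il) (chi : act_dom s) : germ_groupoid :=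
  (\pi_({eq_quot germ_equivR}) (existT _ s chi))%qT.

Definition germ_src (g : germ_groupoid) : bdryOmega := germ_chr (repr g).

(* The next lemmas say that, for every [s], [germ s] is a homeomorphism from
   [act_dom s] onto an open subset of [germ_groupoid], inverse to [germ_src]. *)
Lemma germ_piP (p q : germ_pairs) :
  (\pi_({eq_quot germ_equivR}) p)%qT = (\pi_({eq_quot germ_equivR}) q)%qT <->
  germ_equiv p q.
Proof.
by split=> H; apply/(@eqquotP _ germ_equivR {eq_quot germ_equivR}%qT p q).
Qed.

Lemma germP (s t : Il) (chi : act_dom s) (psi : act_dom t) :
  germ chi = germ psi <-> germ_equiv (existT _ s chi) (existT _ t psi).
Proof. exact: (germ_piP (existT _ s chi) (existT _ t psi)). Qed.

Lemma germ_srcE (s : Il) (chi : act_dom s) : germ_src (germ chi) = set_val chi.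
Proof.
rewrite /germ_src; have : germ_equiv (repr (germ chi)) (existT _ s chi).
  by apply/germ_piP; exact: reprK.
by move=> /asboolP[->].
Qed.

Lemma germ_inj (s : Il) : injective (@germ s).
Proof.
by move=> chi psi /(congr1 germ_src); rewrite !germ_srcE => /val_inj.
Qed.

Lemma germ_continuous (s : Il) : continuous (@germ s).
Proof.
move=> chi.
have := @continuous_comp _ _ germ_groupoid
  (existT _ s : act_dom s -> {s : Il & act_dom s})
  (fun p => (\pi_({eq_quot germ_equivR}) p)%qT) chi.
apply; first exact: existT_continuous.
exact: pi_continuous.
Qed.

Lemma germ_open_map (s : Il) (U : set (act_dom s)) :
  open U -> open (@germ s @` U).
Proof.
move=> [V oV VU]; apply/sigT_openP => t.
rewrite openE => chi [psi Upsi /germP /asboolP[]].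
rewrite /germ_chr /= => psichi [eps Jeps [ceps E]].
have Vchi : V (set_val chi) by rewrite -psichi; move: Upsi; rewrite -VU.
have ds : chr (bdry_chr (set_val chi)) (Jdom s).
  by rewrite -psichi; exact: (set_valP psi).
rewrite psichi in ceps.
have cont : (fun x : act_dom t => bdry_chr (set_val x)) x @[x --> chi] -->
    bdry_chr (set_val chi).
  apply: (@continuous_comp _ _ _ set_val set_val); exact: initial_continuous.
have N1 : \forall x \near chi, V (set_val x).
  apply: (@initial_continuous _ _ set_val chi); exact: open_nbhs_nbhs.
have N2 : \forall x \near chi, chr (bdry_chr (set_val x)) (Jdom s).
  apply: (cont [set psi | chr psi (Jdom s)]).
  exact: (open_nbhs_nbhs (conj (chr_open (Jdom s) true) ds)).
have N3 : \forall x \near chi, chrbar (bdry_chr (set_val x)) eps.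
  by apply: (cont [set psi | chrbar psi eps]); exact: chrbar_near.
apply: filterS (filterI N1 (filterI N2 N3)) => x [Vx [xs cx]].
exists (exist _ (set_val x) (mem_set xs)); first by rewrite -VU.
apply/germP/asboolP; split; first exact: val_inj.
by exists eps.
Qed.

End LeftInverseHull.

(* Main.v *)
(** The germs of [s] and [t] at [chi] agree iff [chi] is supported on some [eps]
    fixed by [t^-1 s].  Given a finite family for [t^-1 s], this is equivalent to
    [chi(eps_i) = 1] for some [i]: otherwise a nearby maximal character would
    contain a nonempty [g] in [J] fixed by [t^-1 s] and disjoint from every
    [eps_i].  The complement is then open, so distinct germs at [chi] can be
    separated.
    Conversely, if the groupoid is Hausdorff, the set of [chi] at which the germs
    of [s] and [s^-1 s] agree is closed in the compact space
    [{chi | chi(s^-1 s) = 1}], hence is covered by finitely many of the open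
    sets [{chi | chi(eps) = 1}] with [s eps = eps].  Every nonempty [e] in [J]
    fixed by [s] lies in a maximal character, which belongs to that set, so [e]
    meets one of the chosen [eps]. *)
Require Import Defs.
From mathcomp Require Import all_boot all_classical topology.

Set Implicit Arguments.
Unset Strict Implicit.
Unset Printing Implicit Defensive.

Local Open Scope classical_set_scope.

(** * Maximal characters and their values on [Jbar] *)

Section Characters.
Variable C : smallCategory.
Implicit Types (chi psi : @Jhat C) (e f g h : @J C) (eps : set C).

Lemma J_neq0_of_chr chi e : chr chi e -> set_val e !=set0.
Proof.
move=> chie; apply/set0P/negP => /eqP e0.
have [_ _ /(_ e e0) chi0] := set_valP chi.
by move: chie; rewrite (chi0 : chr chi e = false).
Qed.

Lemma chr_le chi e f : set_val e `<=` set_val f -> chr chi e -> chr chi f.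
Proof.
move=> ef; suff <- : Jmeet e f = e by rewrite chrI => /andP[].
by apply: J_inj; exact/setIidPl.
Qed.

Lemma chr_bigmeet chi n (g : 'I_n -> @J C) :
  (forall i, chr chi (g i)) ->
  exists2 h, chr chi h & forall i, set_val h `<=` set_val (g i).
Proof.
elim: n g => [|n IHn] g chig.
  by have [[e chie] _ _] := set_valP chi; exists e => // -[].
have [h chih hg] := IHn (fun i => g (lift ord0 i)) (fun i => chig _).
exists (Jmeet (g ord0) h); first by rewrite chrI chig.
move=> i x [/= g0x hx]; case: (unliftP ord0 i) => [j ->|->] //.
exact: hg.
Qed.

(** Otherwise every member of the filter of [chi] meets [f], and the sets containing the
    intersection of [f] with some member form a character that extends [chi] and contains [f],
    against maximality. *)
Lemma maximal_chr_disjoint chi f : maximal_chr chi -> ~~ chr chi f ->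
  exists2 g, chr chi g & set_val g `&` set_val f = set0.
Proof.
move=> chimax nchif; apply: contrapT => nsep.
have [[e chie] _ _] := set_valP chi.
pose psi h := `[< exists2 g, chr chi g &
  set_val g `&` set_val f `<=` set_val h >].
have psiP : Jhat psi.
  split.
  - by exists f; apply/asboolP; exists e => // x [].
  - move=> a b; apply/asboolP/andP.
      by move=> [g chig H]; split; apply/asboolP; exists g => // x /H[].
    move=> [/asboolP[g chig ga] /asboolP[h chih hb]].
    exists (Jmeet g h); first by rewrite chrI chig.
    by move=> x [[gx hx] fx]; split; [apply: ga|apply: hb].
  - move=> a a0; apply/asboolP => -[g chig]; rewrite a0 subset0 => H.
    by apply: nsep; exists g.
have /chimax E : [set h | chr chi h] `<=`
    [set h | chr (exist _ psi (mem_set psiP)) h].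
  by move=> h /= chih; apply/asboolP; exists h => // x [].
suff : [set h | chr chi h] f by exact/negP.
by rewrite -E /=; apply/asboolP; exists e => // x [].
Qed.

(** Each excluded [f i] is avoided by some member of the filter; the meet of [e] with a common lower
    bound of these members avoids them all. *)
Lemma maximal_chr_sub chi eps : maximal_chr chi -> chrbar chi eps ->
  exists2 g, chr chi g & set_val g `<=` eps.
Proof.
move=> chimax [e [n [f [_ -> chie chif]]]].
have /choice[g gP] i : exists g, chr chi g /\ set_val g `&` set_val (f i) = set0.
  by have [g] := maximal_chr_disjoint chimax (chif i); exists g.
have [h chih hg] := chr_bigmeet (fun i => (gP i).1).
exists (Jmeet e h); first by rewrite chrI chie.
move=> x [/= ex hx]; split=> // -[i _ fx].
have : (set_val (g i) `&` set_val (f i)) x by split=> //; exact: hg.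
by rewrite (gP i).2.
Qed.

(** Value 0 has two causes: either [e] is outside the filter, and some member avoids [e], or some
    [f i] is inside it and is itself disjoint from [eps]. *)
Lemma maximal_chrbar_disjoint chi eps :
  maximal_chr chi -> Jbar eps -> ~ chrbar chi eps ->
  exists2 g, chr chi g & set_val g `&` eps = set0.
Proof.
move=> chimax [e [n [f [fe ->]]]] nchi.
have [chie|nchie] := boolP (chr chi e); last first.
  have [g chig ge] := maximal_chr_disjoint chimax nchie.
  exists g => //; apply/seteqP; split=> // x [gx [ex _]].
  by have : (set_val g `&` set_val e) x by []; rewrite ge.
have [i chifi] : exists i, chr chi (f i).
  apply: contrapT => nf; apply: nchi; exists e, n, f; split=> // i.
  by apply/negP => chifi; apply: nf; exists i.
exists (f i) => //; apply/seteqP; split=> // x [fx [_]]; apply.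
by exists i.
Qed.

Lemma chrbar_neq0 chi eps : Omega chi -> chrbar chi eps -> eps !=set0.
Proof.
move=> Ochi [e [n [f [fe -> chie chif]]]]; apply/set0P/negP => /eqP ef0.
have [|i] := Omega_cover Ochi (f := f) _ chie.
  by rewrite -setD_eq0.
by apply/negP.
Qed.

Lemma chr_chrbar chi e : chr chi e -> chrbar chi (set_val e).
Proof.
move=> chie; exists e, 0%N, (fun=> e); split=> //; [by case| |by case].
by apply/seteqP; split=> [x ex|x []//]; split=> // -[[]].
Qed.

Lemma near_chr_eq chi e : \forall psi \near chi, chr psi e = chr chi e.
Proof. exact: (open_nbhs_nbhs (conj (chr_open e (chr chi e)) erefl)). Qed.

(** The value at [eps] is read off from finitely many coordinates, each locally constant; [Omega]
    makes it independent of the presentation of [eps]. *)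
Lemma chrbar_nearN chi eps : Omega chi -> Jbar eps -> ~ chrbar chi eps ->
  \forall psi \near chi, Omega psi -> ~ chrbar psi eps.
Proof.
move=> Ochi [e [n [f [fe ->]]]] nchi.
have near_f : \forall psi \near chi, forall i, chr psi (f i) = chr chi (f i).
  apply: (@filter_forall _ 'I_n
    (fun i => [set psi | chr psi (f i) = chr chi (f i)]) (nbhs chi)) => i.
  exact: near_chr_eq.
apply: filterS (filterI (near_chr_eq chi e) near_f) => psi [Ee Ef] Opsi.
move=> /(chrbarE Opsi fe)[psie psif]; apply/nchi/chrbarE => //.
by rewrite -Ee; split=> // i; rewrite -Ef.
Qed.

(** Zorn's lemma among the characters containing [e], which include the principal filter [psi] of
    the nonempty set [e]. *)
Lemma maximal_chr_exists e : set_val e !=set0 ->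
  exists2 chi, maximal_chr chi & chr chi e.
Proof.
move=> [x0 ex0].
pose psi h := `[< set_val e `<=` set_val h >].
have psiP : Jhat psi.
  split.
  - by exists e; apply/asboolP.
  - move=> a b; apply/asboolP/andP.
      by move=> H; split; apply/asboolP => x /H[].
    by move=> [/asboolP ea /asboolP eb] x ex; split; [exact: ea|exact: eb].
  - by move=> a a0; apply/asboolP; rewrite a0 => /(_ _ ex0).
pose T := {chi | chr chi e}.
pose mkT chi (chie : chr chi e) : T :=
  exist (fun chi => is_true (chr chi e)) chi chie.
have psie : chr (exist _ psi (mem_set psiP)) e by apply/asboolP.
pose R (a b : T) := `[< [set h | chr (sval a) h] `<=` [set h | chr (sval b) h] >].
have [||A totA|[chi chie] chimax] := @ZL_preorder T (mkT _ psie) R.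
- by move=> a; apply/asboolP.
- move=> b a c /asboolP ab /asboolP bc; apply/asboolP.
  exact: subset_trans ab bc.
(* A nonempty chain is bounded by its union; the union of the empty chain would be the zero map, so
   [psi] serves there. *)
- have [[a0 Aa0]|A0] := pselect (A !=set0); last first.
    by exists (mkT _ psie) => a Aa; exfalso; apply: A0; exists a.
  pose phi h := `[< exists2 a, A a & chr (sval a) h >].
  have phiP : Jhat phi.
    split.
    - by exists e; apply/asboolP; exists a0 => //; exact: (svalP a0).
    - move=> f g; apply/asboolP/andP.
        move=> [a Aa]; rewrite chrI => /andP[af ag].
        by split; apply/asboolP; exists a.
      move=> [/asboolP[a Aa af] /asboolP[b Ab bg]].
      have [/asboolP ab|/asboolP ba] := totA a b Aa Ab.
        by exists b => //; rewrite chrI bg andbT; exact: ab.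
      by exists a => //; rewrite chrI af; exact: ba.
    - move=> f f0; apply/asboolP => -[a _ /J_neq0_of_chr].
      by rewrite f0 => -[].
  have phie : chr (exist _ phi (mem_set phiP)) e.
    by apply/asboolP; exists a0 => //; exact: (svalP a0).
  exists (mkT _ phie) => a Aa; apply/asboolP => h ah.
  by apply/asboolP; exists a.
(* Maximality among characters containing [e] is full maximality, since any larger character still
   contains [e]. *)
- exists chi => // xi chixi; apply/seteqP; split=> //.
  have xie : chr xi e by exact: chixi.
  by have /asboolP := chimax (mkT _ xie) (asboolT chixi).
Qed.

End Characters.

(** * Agreement of partial bijections and fixed sets *)

Section PartialBijections.
Variable T : Type.
Implicit Types (s t : pbij T) (A : set T).

Lemma pbfixesS s A B : B `<=` A -> pbfixes s A -> pbfixes s B.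
Proof.
by move=> BA [As sA]; split=> [x /BA/As|x /BA/sA].
Qed.

Lemma pbfixes_of_graph s A : (forall x, A x -> s x x) -> pbfixes s A.
Proof. by move=> sA; split=> // x Ax; exists x; exact: sA. Qed.

Lemma pbfixes_restr s t A : pbfixes (pbcomp (pbinv t) s) A ->
  pbrestr s A = pbrestr t A.
Proof.
move=> [_ fixA]; apply: pbij_eq => x y /=.
split=> -[Ax xy]; split=> //; have [z sxz tzx] := fixA x Ax.
  by rewrite (pbij_fun xy sxz).
by rewrite (pbij_fun xy tzx).
Qed.

(** The inclusion in [pbdom s] rules out points where the restrictions agree because both are
    undefined. *)
Lemma restr_pbfixes s t A : A `<=` pbdom s -> pbrestr s A = pbrestr t A ->
  pbfixes (pbcomp (pbinv t) s) A.
Proof.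
move=> As E; apply: pbfixes_of_graph => x Ax; have [y sxy] := As x Ax.
exists y => //; have : pbrestr s A x y by [].
by rewrite E => -[].
Qed.

End PartialBijections.

(** * Germs and their base characters *)

Section Germs.
Variable C : smallCategory.
Implicit Types s t : @Il C.

Definition germ_base s (x : act_dom s) : @Jhat C := bdry_chr (set_val x).

Lemma germ_base_continuous s : continuous (@germ_base s).
Proof.
move=> x; apply: (@continuous_comp _ _ _ set_val set_val);
exact: initial_continuous.
Qed.

Lemma germ_base_Omega s (x : act_dom s) : Omega (germ_base x).
Proof. exact: bdryOmega_Omega (set_valP (set_val x)). Qed.

Lemma germ_base_inj s (x y : act_dom s) : germ_base x = germ_base y -> x = y.
Proof. by move=> xy; apply/val_inj/val_inj. Qed.

Lemma germ_eqP s t (x : act_dom s) (y : act_dom t) :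
  germ x = germ y <-> germ_base x = germ_base y /\
  exists2 eps, chrbar (germ_base x) eps &
    pbrestr (set_val s) eps = pbrestr (set_val t) eps.
Proof.
split=> [/germP/asboolP[xy [eps _ [ceps E]]]|[xy [eps ceps E]]].
  by split; [rewrite /germ_base /bdry_chr [set_val x]xy|exists eps].
apply/germP/asboolP; split; first exact: val_inj.
by exists eps => //; exact: chrbar_Jbar ceps.
Qed.

Lemma germ_surj (a : germ_groupoid C) : exists s (x : act_dom s), a = germ x.
Proof.
have -> : a = (\pi_({eq_quot germ_equivR C}) (repr a))%qT.
  by rewrite reprK.
by case: (repr a) => s x; exists s, x.
Qed.

(** * Compactness of the domains of the action *)

Lemma initial_cvg (S : choiceType) (T : topologicalType) (f : S -> T)
    (F : set_system S) (x : S) : Filter F ->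
  f y @[y --> F] --> f x -> F --> (x : initial_topology f).
Proof.
move=> FF Ff U; rewrite nbhsE => -[V [[W oW <-] Wx] VU].
by apply: filterS VU _; apply: Ff; exact: open_nbhs_nbhs.
Qed.

Lemma fmap_ultra (S T : Type) (f : S -> T) (F : set_system S) :
  UltraFilter F -> UltraFilter (f @ F).
Proof.
move=> FU; apply: Build_UltraFilter => G GP FG.
apply/seteqP; split=> // A GA.
have [//|FnA] := in_ultra_setVsetC (f @^-1` A) FU.
have [x [Ax]] := filter_ex (filterI GA (FG (~` A) FnA)).
by [].
Qed.

(** An ultrafilter converges in the compact product of copies of [bool]; the limit inherits the
    conditions defining [Jhat], [bdryOmega] and [act_dom s] in turn, and so lifts through these
    nested subspaces. *)
Lemma act_dom_compact s : compact [set: act_dom s].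
Proof.
rewrite compact_ultra => F UF _.
pose emb (x : act_dom s) : {ptws @J C -> bool} := set_val (germ_base x).
have [chi [_ Fchi]] : ([set: {ptws @J C -> bool}] `&`
    [set chi | emb x @[x --> F] --> chi]) !=set0.
  have cpt : compact [set: {ptws @J C -> bool}].
    have := @tychonoff (@J C) (fun=> bool) (fun=> setT) (fun=> bool_compact).
    by congr compact; apply/seteqP; split.
  move: cpt; rewrite compact_ultra => /(_ _ (fmap_ultra emb UF)); apply.
  exact: filterT.
have near_eq h : \forall x \near F, chr (germ_base x) h = chi h.
  apply: (Fchi [set phi : {ptws @J C -> bool} | phi h = chi h]).
  apply: (@proj_continuous _ (fun=> bool) h chi [set chi h]).
  by apply: open_nbhs_nbhs; split=> //; exact: discrete_open.
have chiP : Jhat chi.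
  split.
  (* Being nonzero need not survive limits; here the coordinate [Jdom s] is constantly 1 and stays
     1. *)
  - have [x xs] := filter_ex (near_eq (Jdom s)).
    by exists (Jdom s); rewrite -xs; exact: (set_valP x).
  - move=> e f.
    have [x [xef [xe xf]]] := filter_ex (filterI (near_eq (Jmeet e f))
      (filterI (near_eq e) (near_eq f))).
    by rewrite -xef -xe -xf chrI.
  - move=> e e0; have [x <-] := filter_ex (near_eq e).
    by have [_ _] := set_valP (germ_base x); apply.
pose chi1 : @Jhat C := exist _ chi (mem_set chiP).
have Fchi1 : germ_base x @[x --> F] --> chi1 by exact: initial_cvg.
have chi1b : bdryOmega chi1.
  move=> B Bchi; have [B' [oB' B'chi] B'B] : exists2 B' : set (@Jhat C),
    open B' /\ B' chi1 & B' `<=` B by move: Bchi; rewrite nbhsE.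
  have FB' := Fchi1 _ (open_nbhs_nbhs (conj oB' B'chi)).
  have [x B'x] := @filter_ex _ F _ _ FB'.
  have [psi [psimax B'psi]] :=
    set_valP (set_val x) B' (open_nbhs_nbhs (conj oB' B'x)).
  by exists psi; split=> //; exact: B'B.
have chi1s : act_dom s (exist _ chi1 (mem_set chi1b)).
  have [x xs] := filter_ex (near_eq (Jdom s)).
  by move: (set_valP x : chr (germ_base x) (Jdom s)); rewrite xs.
pose chi2 : @bdryOmega C := exist _ chi1 (mem_set chi1b).
have Fchi2 : set_val x @[x --> F] --> chi2 by exact: initial_cvg.
by exists (exist _ chi2 (mem_set chi1s)); split=> //; exact: initial_cvg.
Qed.

(** * From finite covers to the Hausdorff property *)

Definition essential_fixed_cover (s : pbij C) :=
  exists (n : nat) (eps : 'I_n -> set C),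
    (forall i, Jbar (eps i) /\ pbfixes s (eps i)) /\
    (forall e : set C, J e -> e !=set0 -> pbfixes s e ->
       exists i, e `&` eps i !=set0).

(** The cover condition tests only members of [J]. A maximal character near [chi] transfers it to
    [d], because [d] then contains a member of the filter, again fixed by [r]. *)
Lemma chrbar_fixed_cover (r : pbij C) n (eps : 'I_n -> set C) (d : set C)
    (chi : @Jhat C) :
  (forall i, Jbar (eps i)) ->
  (forall e : set C, J e -> e !=set0 -> pbfixes r e ->
     exists i, e `&` eps i !=set0) ->
  bdryOmega chi -> chrbar chi d -> pbfixes r d ->
  exists i, chrbar chi (eps i).
Proof.
move=> Jeps cover chib chid fixd; apply: contrapT => neps.
have Neps : \forall psi \near chi,
    forall i, Omega psi -> ~ chrbar psi (eps i).
  apply: (@filter_forall _ 'I_n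
    (fun i => [set psi | Omega psi -> ~ chrbar psi (eps i)]) (nbhs chi)) => i.
  apply: chrbar_nearN => //; first exact: bdryOmega_Omega.
  by move=> epsi; apply: neps; exists i.
have [psi [psimax [psid psin]]] := chib _ (filterI (chrbar_near chid) Neps).
have [g psig gd] := maximal_chr_sub psimax psid.
(* These [h i] yield [Jmeet g k], which is nonempty, fixed by [r] and disjoint from every [eps i],
   contradicting [cover]. *)
have /choice[h hP] i :
    exists h, chr psi h /\ set_val h `&` eps i = set0.
  have [|h] := @maximal_chrbar_disjoint _ psi (eps i) psimax (Jeps i).
    exact: psin (maximal_chr_Omega psimax).
  by exists h.
have [k psik kh] := chr_bigmeet (fun i => (hP i).1).
have psigk : chr psi (Jmeet g k) by rewrite chrI psig.
have [|i [x [[gx kx] epsx]]] :=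
    cover _ (set_valP (Jmeet g k)) (J_neq0_of_chr psigk).
  by apply: pbfixesS fixd => x [/gd].
have : (set_val (h i) `&` eps i) x by split=> //; exact: kh.
by rewrite (hP i).2.
Qed.

Lemma hausdorff_of_fixed_cover :
  (forall s : pbij C, Il s -> essential_fixed_cover s) ->
  hausdorff_space (germ_groupoid C).
Proof.
move=> cover; rewrite open_hausdorff => a b /eqP.
have [s [x ->]] := germ_surj a; have [t [y ->]] := germ_surj b => {a b} nxy.
(* As [germ] is an open map, it suffices to separate within the two domains. *)
suff [U [V [nxU nyV UV]]] : exists (U : set (act_dom s)) (V : set (act_dom t)),
    [/\ \forall z \near x, U z, \forall z \near y, V z &
     forall z w, U z -> V w -> germ z <> germ w].
  exists (@germ _ s @` U°, @germ _ t @` V°) => /=.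
    by split; apply/mem_set; [exists x|exists y].
  split; [exact/germ_open_map/open_interior|exact/germ_open_map/open_interior|].
  apply/eqP/seteqP; split=> // _ [[z Uz <-] [w Vw wz]].
  by apply: (UV z w); [exact: interior_subset Uz|exact: interior_subset Vw|].
(* Distinct base characters differ in a coordinate [e], which is locally constant. *)
have [xy|nb] := pselect (germ_base x = germ_base y); last first.
  have [e nxye] : exists e, chr (germ_base x) e <> chr (germ_base y) e.
    by apply: contrapT => H; apply/nb/val_inj/funext => e; apply: contrapT => ?;
      apply: H; exists e.
  exists [set z | chr (germ_base z) e = chr (germ_base x) e],
    [set z | chr (germ_base z) e = chr (germ_base y) e]; split.
  - exact: (germ_base_continuous (near_chr_eq (germ_base x) e)).
  - exact: (germ_base_continuous (near_chr_eq (germ_base y) e)).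
  - by move=> z w /= zx wy /germ_eqP[zw _]; apply: nxye; rewrite -zx -wy zw.
have [n [eps [epsP epsc]]] :=
  cover _ (Il_comp (Il_inv (set_valP t)) (set_valP s)).
(* Only the neighbourhood of [x] has to shrink: equal germs over [z] would give some [eps i] value 1
   at [z]. *)
exists [set z | forall i, ~ chrbar (germ_base z) (eps i)], setT; split.
- apply: (@filter_forall _ 'I_n
    (fun i => [set z | ~ chrbar (germ_base z) (eps i)]) (nbhs x)) => i.
  have neps : ~ chrbar (germ_base x) (eps i).
    move=> epsi; apply: nxy; apply/germ_eqP; split=> //.
    by exists (eps i) => //; exact: pbfixes_restr (epsP i).2.
  have near_neps := germ_base_continuous
    (chrbar_nearN (@germ_base_Omega _ x) (epsP i).1 neps).
  apply: (@filterS _ (nbhs x) _ _ _ _ near_neps) => z.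
  by apply; exact: germ_base_Omega.
- exact: filterT.
- move=> z w nz _ /germ_eqP[_ [d zd E]].
  have zs : chr (germ_base z) (Jdom s) by exact: (set_valP z).
  (* Cutting [d] down to the domain of [s] keeps the value 1 and meets the domain condition of
     [restr_pbfixes]. *)
  have zds := chrbarI zd (chr_chrbar zs).
  have [||i] := chrbar_fixed_cover (fun i => (epsP i).1) epsc _ zds.
  + exact: (set_valP (set_val z)).
  + by apply: restr_pbfixes; [exact: subIsetr|exact: pbrestrI].
  + exact: nz.
Qed.

(** * From the Hausdorff property to finite covers *)

Lemma fixed_cover_of_hausdorff (s : pbij C) :
  hausdorff_space (germ_groupoid C) -> Il s -> essential_fixed_cover s.
Proof.
rewrite open_hausdorff => H Is.
pose s' : @Il C := exist _ s (mem_set Is).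
pose i' : @Il C :=
  exist _ (pbcomp (pbinv s) s) (mem_set (Il_comp (Il_inv Is) Is)).
have iE (x y : C) : set_val i' x y <-> pbdom s x /\ x = y.
  split=> [[z /= sxz syz]|[[z sxz] <-]]; last by exists z.
  by split; [exists z|exact: pbij_inj sxz syz].
have dom_i (x : act_dom s') : act_dom i' (set_val x).
  rewrite /act_dom /=; suff -> : Jdom i' = Jdom s' by exact: (set_valP x).
  apply: J_inj; apply/seteqP; split=> z.
    by move=> [y /iE[]].
  by move=> zs; exists z; apply/iE.
(* [toi] keeps the character and replaces [s] by its domain idempotent, so [germ (toi x)] is the
   unit at the base of [x]. *)
pose toi (x : act_dom s') : act_dom i' :=
  exist _ (set_val x) (mem_set (dom_i x)).
have toi_continuous : continuous toi.
  move=> x; have val_cvg : set_val y @[y --> x] --> set_val x.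
    exact: initial_continuous.
  exact: (@initial_cvg (act_dom i') _ set_val _ (toi x)
    (fmap_filter toi (nbhs_filter x)) val_cvg).
pose good eps := Jbar eps /\ pbfixes s eps.
have germ_good (x : act_dom s') : germ x = germ (toi x) <->
    exists2 eps, good eps & chrbar (germ_base x) eps.
  split=> [/germ_eqP[_ [eps ceps E]]|[eps [_ fixeps] ceps]].
    have xs : chr (germ_base x) (Jdom s') by exact: (set_valP x).
    have cs := chrbarI ceps (chr_chrbar xs).
    (* On [pbdom s] the element [i'] is the identity, so agreeing with it there means being fixed by
       [s]. *)
    exists (eps `&` pbdom s) => //; split; first exact: chrbar_Jbar cs.
    apply: pbfixes_of_graph => z [epsz sz].
    have : pbrestr (set_val i') eps z z by split=> //; exact/iE.
    by rewrite -E => -[].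
  apply/germ_eqP; split=> //; exists eps => //.
  apply: pbij_eq => y z /=; split=> -[epsy yz]; split=> //.
    by apply/iE; split; [exists z|exact: pbij_fun (fixeps.2 _ epsy) yz].
  by move: yz => /iE[_ <-]; exact: fixeps.2.
(* Finite lists filtered by inclusion, so that the near-covering form of
   compactness yields a finite subcover without a base point. *)
pose F : set_system (seq (set C)) :=
  [set A | exists l0 : seq (set C), forall l, {subset l0 <= l} -> A l].
have FF : Filter F.
  split.
  - by exists [::].
  - move=> P Q [l P_l] [k Q_k]; exists (l ++ k) => m lkm.
    split; [apply: P_l|apply: Q_k] => a am; apply: lkm;
      by rewrite mem_cat am ?orbT.
  - by move=> P Q PQ [l P_l]; exists l => k lk; exact/PQ/P_l.
have /compact_near_coveringP cov := act_dom_compact (s := s').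
(* Stating the covering as an implication lets compactness of the whole [act_dom s'] apply directly
   to the locus where the germs agree. *)
have [l lP] : F [set l | [set: act_dom s'] `<=` fun x => germ x = germ (toi x) ->
    exists eps, [/\ eps \in l, good eps & chrbar (germ_base x) eps]].
  apply: (cov _ F (fun l (x : act_dom s') => germ x = germ (toi x) ->
    exists eps, [/\ eps \in l, good eps & chrbar (germ_base x) eps]) FF).
  move=> x _; have [xx|nxx] := pselect (germ x = germ (toi x)).
    have [eps epsg xeps] := (germ_good x).1 xx.
    exists ([set z | chrbar (germ_base z) eps], [set l | eps \in l]) => /=.
      split; first exact: (germ_base_continuous (chrbar_near xeps)).
      by exists [:: eps] => l; apply; rewrite mem_seq1.
    by move=> [z l] /= [zeps epsl] _; exists eps.
  (* Separating the two germs keeps them distinct near [x], where the implication is vacuous. *)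
  have /eqP/H[[A B] /= [/set_mem Ax /set_mem Bx] [oA oB /eqP AB]] := nxx.
  exists ([set z | A (germ z) /\ B (germ (toi z))], setT) => /=.
    split; last exact: filterT.
    apply: filterI.
      by apply: germ_continuous; exact: open_nbhs_nbhs.
    apply: (continuous_comp (@toi_continuous x) (@germ_continuous _ i' (toi x))).
    exact: open_nbhs_nbhs.
  move=> [z l] /= [[Az Bz] _] zz; rewrite -zz in Bz.
  by have : (A `&` B) (germ z) by []; rewrite AB.
(* Nothing forces all members of [l] to be good, so the others are discarded; the default [set0] of
   [nth] is never reached. *)
pose l' := [seq eps <- l | `[< good eps >]].
exists (size l'), (fun i => nth set0 l' i); split=> [i|e Je e0 fixe].
  have : nth set0 l' i \in l' by rewrite mem_nth.
  by rewrite mem_filter => /andP[/asboolP].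
have [chi chimax chie] := @maximal_chr_exists C (exist _ e (mem_set Je)) e0.
have chib : bdryOmega chi by exact: subset_closure.
pose chi' : @bdryOmega C := exist _ chi (mem_set chib).
have chis : act_dom s' chi'.
  by apply: chr_le chie => x /= /fixe.1.
pose x : act_dom s' := exist _ chi' (mem_set chis).
have ce := chr_chrbar chie.
have [] := lP l _ x => //.
  by apply/germ_good; exists e => //; split=> //; exact: chrbar_Jbar ce.
move=> eps [epsl epsg ceps].
have epsl' : eps \in l' by rewrite mem_filter epsl andbT; exact/asboolP.
have lt : (index eps l' < size l')%N by rewrite index_mem.
exists (Ordinal lt); rewrite /= nth_index //.
exact: chrbar_neq0 (maximal_chr_Omega chimax) (chrbarI ce ceps).
Qed.

End Germs.

Theorem lemma5p2 (C : smallCategory) (HC : left_cancellative C) :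
  hausdorff_space (germ_groupoid C) <->
  (forall s : pbij C, Il s ->
     exists (n : nat) (eps : 'I_n -> set C),
       (forall i, Jbar (eps i) /\ pbfixes s (eps i)) /\
       (forall e : set C, J e -> e !=set0 -> pbfixes s e ->
          exists i, e `&` eps i !=set0)).
Proof.
split; last exact: hausdorff_of_fixed_cover.
by move=> H s; exact: fixed_cover_of_hausdorff.
Qed.
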